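(* Let $\Phi$ be a nonempty finite integral gain graph of order $n$ (that is, with $n\ge 1$ vertices). There exist a positive integer $k$, positive integers $d_1=n>d_2,\ldots,d_k$ (that is, $d_1=n$ and $d_j<n$ for $2\le j\le k$), polynomials $p_j(\lambda)=(\lambda-r_{j1})(\lambda-r_{j2})\cdots(\lambda-r_{jd_j})$ of degree $d_j$ with integral roots $r_{j1}\ge r_{j2}\ge\cdots\ge r_{jd_j}\ge 0$ for $1\le j\le k$ and with $p_1(\lambda)=\lambda^n$, and positive integers $\mu_1=1,\mu_2,\ldots,\mu_k$, such that for every integer $m\ge 0$ $$\chi^{\mathbb Z}_\Phi(m)=m^n+\sum_{\substack{2\le j\le k\\ r_{j1}\le m}}(-1)^{n-d_j}\mu_j\,p_j(m),$$ where $\chi^{\mathbb Z}_\Phi(m)$ is the number of proper integral $m$-colorations of $\Phi$.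
   Context: An integral gain graph $\Phi$ consists of a graph $(V,E)$ (loops and multiple edges allowed) and a gain function $\varphi$ assigning an integer to each oriented edge, with $\varphi(e^{-1})=-\varphi(e)$ when $e^{-1}$ is $e$ with the opposite orientation. The order of $\Phi$ is its number of vertices. The notation $g e_{ij}$ means an edge with endpoints $v_i,v_j$ whose gain in the direction from $v_i$ to $v_j$ is $g$. For an integer $m\ge 0$, $[m]=\{1,\dots,m\}$, with $[0]=\varnothing$. An integral $m$-coloration is a function $x:V\to[m]$, $v_i\mapsto x_i$; it is proper if $x_j\ne x_i+g$ for every edge $g e_{ij}$ of $\Phi$.
   Formalization: The formal theorem additionally assumes that Φ has no loop of gain 0; with such a loop there are no proper m-colorations for m ≥ 1, while the right-hand side has leading term m^n, so the claim as stated is false there. *)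

(* Defs.v *)
From HB Require Import structures.
From mathcomp Require Import all_boot all_order all_algebra.

Set Implicit Arguments.
Unset Strict Implicit.
Unset Printing Implicit Defensive.

Import Order.TTheory GRing.Theory Num.Theory.
Local Open Scope ring_scope.

(* Loops and parallel edges are allowed.  The order of the two endpoints is   *)
(* only a reference orientation used to name the two orientations of an edge. *)
Record multigraph := Multigraph {
  vertex : finType;
  edge : finType;
  endpoints : edge -> vertex * vertex
}.

(* (e, false) is e in its reference orientation, (e, true) is the reverse; a  *)
(* loop also has two orientations.                                            *)
Definition oedge (G : multigraph) : finType := (edge G * bool)%type.

Definition orev (G : multigraph) (e : oedge G) : oedge G := (e.1, ~~ e.2).

Definition otail (G : multigraph) (e : oedge G) : vertex G :=
  if e.2 then (endpoints e.1).2 else (endpoints e.1).1.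

Definition ohead (G : multigraph) (e : oedge G) : vertex G :=
  otail (orev e).

Record int_gain_graph := IntGainGraph {
  underlying :> multigraph;
  gain : oedge underlying -> int;
  gain_rev : forall e : oedge underlying, gain (orev e) = - gain e
}.

Definition gorder (Phi : int_gain_graph) : nat := #|vertex Phi|.

(* A loop of gain 0 forbids every coloration with at least one color          *)
(* (x_i <> x_i + 0), so the coloration count is then identically 0 and has no *)
(* expansion with leading term m ^ n.                                         *)
Definition no_neutral_loop (Phi : int_gain_graph) : Prop :=
  forall e : oedge Phi, otail e = ohead e -> gain e != 0.

(* 'I_m is {0, ..., m - 1}; the colors are 1, ..., m. *)
Definition color (m : nat) (c : 'I_m) : int := c.+1%:Z.

Definition proper_coloration (Phi : int_gain_graph) (m : nat)
    (x : {ffun vertex Phi -> 'I_m}) : bool :=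
  [forall e : oedge Phi, color (x (ohead e)) != color (x (otail e)) + gain e].

Definition chromZ (Phi : int_gain_graph) (m : nat) : nat :=
  #|[set x : {ffun vertex Phi -> 'I_m} | proper_coloration x]|.

(* Main.v *)
(* Delete and contract: colorations proper for E minus those proper for       *)
(* e :: E are those proper for E that satisfy the equation of e.  Contracting *)
(* is done without changing the vertex set, by recording the equations x_v =  *)
(* x_(root v) + off v imposed so far.  When only equations remain, each block *)
(* has max(m - h, 0) colorations, where h >= 0 is the spread of its offsets,  *)
(* so each leaf contributes a product of truncated differences, one factor    *)
(* per block.  Every contraction merges two blocks and changes the sign,      *)
(* hence the sign (-1)^(n - d); all multiplicities can be taken equal to 1,   *)
(* because the p_j need not be distinct.                                      *)
Require Import Defs.
From HB Require Import structures.
From mathcomp Require Import all_boot all_order all_algebra.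
From mathcomp Require Import zify.

Set Implicit Arguments.
Unset Strict Implicit.
Unset Printing Implicit Defensive.

Import Order.TTheory GRing.Theory Num.Theory.
Local Open Scope ring_scope.

(** Induction on the list of edges, over all frames at once. Splitting the colorations by whether
    they satisfy [e] gives deletion-contraction ([proper_count_merge]); when both ends of [e] lie in
    one block, either all tied colorations satisfy [e] or none does ([tied_eq_root]). With no edges
    left, blocks are colored independently, and a block of spread h leaves max(m - h, 0) colors for
    its root ([proper_count_nil]). This truncation is the source of the condition r_{j1} <= m: a
    product vanishes when m is below its largest spread ([prod_subn_horner]). The trivial frame
    yields m^n, and each merge lowers the degree by one. *)

Section Frames.

Variable V : finType.

(* A balanced flat: a partition of V into blocks with a marked representative *)
(* and a potential.                                                           *)
Record frame := Frame {
  root : V -> V;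
  off : V -> int;
  root_idem : forall v, root (root v) = root v;
  off_root : forall v, off (root v) = 0
}.

Definition trivial_frame : frame :=
  @Frame id (fun=> 0) (fun=> erefl) (fun=> erefl).

Definition roots (s : frame) : {set V} := [set v | root s v == v].

Definition tied (s : frame) m (x : {ffun V -> 'I_m}) : bool :=
  [forall v, (x v)%:Z == (x (root s v))%:Z + off s v].

(* (u, v, g) is an edge of gain g in the direction from u to v. *)
Definition satisfied m (x : {ffun V -> 'I_m}) (e : V * V * int) : bool :=
  (x e.1.2)%:Z == (x e.1.1)%:Z + e.2.

Definition implied (s : frame) (e : V * V * int) : bool :=
  (root s e.1.1 == root s e.1.2) && (off s e.1.2 == off s e.1.1 + e.2).

Definition proper_count (s : frame) (E : seq (V * V * int)) m : nat :=
  #|[set x : {ffun V -> 'I_m} | tied s x && all (predC (satisfied x)) E]|.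

(** * Contraction: merging two blocks along an edge *)

Section Merge.

Variables (s : frame) (e : V * V * int).
Hypothesis neq_root : root s e.1.1 != root s e.1.2.

Definition merge_root w :=
  if root s w == root s e.1.2 then root s e.1.1 else root s w.

(** The shift is forced by the equation of [e]: the new offset of [e.1.2] is that of [e.1.1] plus
    the gain. *)
Definition merge_off w :=
  if root s w == root s e.1.2 then off s w + (off s e.1.1 + e.2 - off s e.1.2)
  else off s w.

Lemma merge_root_idem w : merge_root (merge_root w) = merge_root w.
Proof.
rewrite /merge_root; case: (eqVneq (root s w)) => [_|nw].
  by rewrite root_idem (negbTE neq_root).
by rewrite root_idem (negbTE nw).
Qed.

Lemma merge_off_root w : merge_off (merge_root w) = 0.
Proof.
rewrite /merge_off /merge_root; case: (eqVneq (root s w)) => [_|nw].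
  by rewrite root_idem (negbTE neq_root) off_root.
by rewrite root_idem (negbTE nw) off_root.
Qed.

Definition merge : frame := Frame merge_root_idem merge_off_root.

Lemma roots_merge : roots merge = roots s :\ root s e.1.2.
Proof.
apply/setP=> w; rewrite !inE /= /merge_root.
case: (eqVneq w (root s e.1.2)) => [->|nw].
  by rewrite root_idem eqxx /= (negbTE neq_root).
case: (eqVneq (root s w) (root s e.1.2)) => [wE|//].
rewrite wE /= [RHS]eq_sym (negbTE nw); apply: contraNF neq_root => /eqP aw.
by rewrite -wE -aw root_idem.
Qed.

Lemma card_roots_merge : #|roots s| = #|roots merge|.+1.
Proof.
by rewrite roots_merge (cardsD1 (root s e.1.2)) inE root_idem eqxx.
Qed.

Lemma tied_merge m (x : {ffun V -> 'I_m}) :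
  tied merge x = tied s x && satisfied x e.
Proof.
rewrite /satisfied; apply/forallP/andP => [tx|[/forallP tx /eqP xe] w] /=.
  have := tx e.1.2; rewrite /= /merge_root /merge_off eqxx => /eqP xe2.
  have := tx (root s e.1.2).
  rewrite /= /merge_root /merge_off root_idem eqxx off_root => /eqP xr2.
  have := tx e.1.1.
  rewrite /= /merge_root /merge_off (negbTE neq_root) => /eqP xe1.
  split; last by lia.
  apply/forallP=> w; have := tx w; rewrite /= /merge_root /merge_off.
  by case: (eqVneq (root s w)) => [->|//]; move/eqP => xw; lia.
have /eqP xw := tx w; have /eqP x1 := tx e.1.1; have /eqP x2 := tx e.1.2.
rewrite /merge_root /merge_off.
by case: (eqVneq (root s w)) => [wE|_]; [rewrite wE in xw; lia|lia].
Qed.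

Lemma proper_count_merge E m :
  proper_count s E m
    = (proper_count s (e :: E) m + proper_count merge E m)%N.
Proof.
rewrite /proper_count -(cardsID [set x | satisfied x e]) addnC.
congr (_ + _)%N; apply: eq_card => x; rewrite !inE ?tied_merge /=.
  by rewrite andbCA.
by rewrite -!andbA; congr (_ && _); rewrite andbC.
Qed.

End Merge.

(** Both ends are offset from the same root, whose color cancels. *)
Lemma tied_eq_root s m (x : {ffun V -> 'I_m}) e :
  tied s x -> root s e.1.1 = root s e.1.2 -> satisfied x e = implied s e.
Proof.
move=> /forallP tx re; have /eqP x1 := tx e.1.1; have /eqP x2 := tx e.1.2.
rewrite /satisfied /implied re eqxx /= x1 x2 re.
by apply/eqP/eqP; lia.
Qed.

(** * Counting tied colorations block by block *)

Definition posn (z : int) : nat := if z is Posz n then n else 0%N.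

(** Taking positive parts loses nothing: a root has offset 0, so both extremes are nonnegative
    anyway. *)
Definition block_low s v : nat := \max_(u | root s u == v) posn (- off s u).
Definition block_high s v : nat := \max_(u | root s u == v) posn (off s u).
Definition spread s v : nat := (block_low s v + block_high s v)%N.

Definition spreads s : seq nat := [seq spread s v | v <- enum (roots s)].

Lemma size_spreads s : size (spreads s) = #|roots s|.
Proof. by rewrite size_map -cardE. Qed.

Lemma roots_gt0 s (v : V) : (0 < #|roots s|)%N.
Proof. by apply/card_gt0P; exists (root s v); rewrite inE root_idem. Qed.

Lemma card_ord_interval (a b m : nat) :
  #|[pred c : 'I_m | (a <= c) && (c + b < m)]|%N = (m - (a + b))%N.
Proof.
rewrite -sum1_card.
rewrite -(big_mkord (fun i => (a <= i) && (i + b < m))%N (fun=> 1%N)).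
rewrite sum1_count.
have -> : index_iota 0 m = iota 0 m by rewrite /index_iota subn0.
have -> : count (fun i => (a <= i) && (i + b < m))%N (iota 0 m)
        = size (iota a (m - (a + b))).
  rewrite -size_filter; apply/perm_size/uniq_perm.
  - by rewrite filter_uniq ?iota_uniq.
  - exact: iota_uniq.
  - by move=> i; rewrite mem_filter !mem_iota; lia.
by rewrite size_iota.
Qed.

Lemma tied_bounds s m (x : {ffun V -> 'I_m}) v :
  tied s x -> root s v = v ->
  ((block_low s v <= x v) && (x v + block_high s v < m))%N.
Proof.
move=> /forallP tx rv; apply/andP; split.
  apply/bigmax_leqP=> u /eqP ru; have /eqP := tx u; rewrite ru /posn.
  by case E: (- off s u) => [k|k]; lia.
have mgt0 : (0 < m)%N by case: (x v) => c /=; case: m {x tx}; lia.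
have: (block_high s v <= m.-1 - x v)%N.
  apply/bigmax_leqP=> u /eqP ru; have /eqP := tx u; rewrite ru /posn.
  by have := ltn_ord (x u); case E: (off s u) => [k|k]; lia.
by have := ltn_ord (x v); lia.
Qed.

(** Converse of [tied_bounds]: a root color in that interval extends to its whole block. *)
Lemma bounds_off s m (c : nat) v :
  (block_low s (root s v) <= c)%N -> (c + block_high s (root s v) < m)%N ->
  0 <= c%:Z + off s v < m%:Z.
Proof.
move=> lo hi.
have := @leq_bigmax_cond _ (fun u => root s u == root s v)
  (fun u => posn (- off s u)) v (eqxx _).
have := @leq_bigmax_cond _ (fun u => root s u == root s v)
  (fun u => posn (off s u)) v (eqxx _).
rewrite -/(block_low s (root s v)) -/(block_high s (root s v)).
by case: (off s v) => k /=; rewrite ?NegzE ?opprK /=; lia.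
Qed.

Lemma proper_count_nil (v0 : V) s m :
  proper_count s [::] m = (\prod_(h <- spreads s) (m - h))%N.
Proof.
case: m => [|m].
  transitivity 0%N.
    by apply: eq_card0 => x; case: (x v0).
  have : (0 < size (spreads s))%N by rewrite size_spreads roots_gt0.
  by case: (spreads s) => // h t _; rewrite big_cons sub0n mul0n.
pose F v := [pred c : 'I_m.+1 |
  (block_low s v <= c) && (c + block_high s v < m.+1)]%N.
have -> : (\prod_(h <- spreads s) (m.+1 - h))%N
    = #|pfamily ord0 (mem (roots s)) F|.
  rewrite card_pfamily foldrE big_map /spreads !big_map.
  by apply: eq_bigr => v _; rewrite card_ord_interval.
(* Restriction to the roots, padded with [ord0]; it is injective on tied colorations because the
   offsets recover the rest. *)
pose f (x : {ffun V -> 'I_m.+1}) :=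
  [ffun v => if v \in roots s then x v else ord0].
rewrite /proper_count -(@card_in_imset _ _ f); last first.
  move=> x y; rewrite !inE !andbT => /forallP tx /forallP ty /ffunP fxy.
  apply/ffunP=> v; apply: val_inj.
  have := fxy (root s v); rewrite !ffunE inE root_idem eqxx => xyr.
  have /eqP := tx v; have /eqP := ty v; rewrite xyr /=; lia.
apply: eq_card => y; apply/imsetP/pfamilyP => [[x]|[/supportP ysupp yF]].
  rewrite inE andbT => tx ->; split.
    by apply/supportP=> v nv; rewrite ffunE (negbTE nv).
  move=> v vR; rewrite ffunE vR; apply: tied_bounds => //.
  by move: vR; rewrite inE => /eqP.
pose x := [ffun v => inord (absz ((y (root s v))%:Z + off s v)) : 'I_m.+1].
have xE v : (x v)%:Z = (y (root s v))%:Z + off s v.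
  have /yF/andP[lo hi] : root s v \in roots s by rewrite inE root_idem.
  have /andP[z0 zm] := bounds_off lo hi.
  by rewrite ffunE inordK ?gez0_abs // -ltz_nat gez0_abs.
exists x.
  rewrite inE andbT; apply/forallP=> v.
  by rewrite !xE root_idem off_root addr0.
apply/ffunP=> v; rewrite ffunE; case: ifPn => [vR|/ysupp //].
apply: val_inj; move: vR; rewrite inE => /eqP rv.
by have := xE v; have := off_root s v; rewrite rv /=; lia.
Qed.

(** * The deletion-contraction expansion *)

Definition signed_term d m (t : seq nat) : int :=
  (-1) ^+ (d + size t) * (\prod_(h <- t) (m - h))%N%:Z.

(* An implied edge excludes every tied coloration: the leading term survives  *)
(* exactly when no edge is implied.                                           *)
Lemma proper_count_expansion (v0 : V) E s :
  exists ts : seq (seq nat),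
    all (fun t => 0 < size t < #|roots s|)%N ts /\
    forall m, (proper_count s E m)%:Z =
      (proper_count s [::] m)%:Z *+ ~~ has (implied s) E
      + \sum_(t <- ts) signed_term #|roots s| m t.
Proof.
elim: E s => [|e E IH] s.
  by exists [::]; split=> // m; rewrite big_nil addr0.
have [re|re] := eqVneq (root s e.1.1) (root s e.1.2).
  have cnt m : proper_count s (e :: E) m
      = if implied s e then 0%N else proper_count s E m.
    case: ifPn => ie.
      apply: eq_card0 => x; rewrite !inE /=.
      by apply/negP=> /and3P[tx]; rewrite (tied_eq_root tx re) ie.
    apply: eq_card => x; rewrite !inE /=.
    by case tx: (tied s x) => //=; rewrite (tied_eq_root tx re) ie.
  case ie: (implied s e).
    by exists [::]; split=> // m; rewrite cnt /= ie big_nil.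
  have [ts [tsP tsE]] := IH s.
  by exists ts; split=> // m; rewrite cnt /= ie tsE.
have [ts [tsP tsE]] := IH s; have [ts' [tsP' tsE']] := IH (merge re).
(* The leading term of the contraction becomes a lower term here, unless an implied edge kills
   it. *)
pose hs := nseq (~~ has (implied (merge re)) E) (spreads (merge re)).
have dE := card_roots_merge re.
exists (ts ++ hs ++ ts'); split.
  rewrite !all_cat tsP /= all_nseq size_spreads dE ltnSn.
  rewrite (roots_gt0 _ v0) orbT /=.
  by apply: sub_all tsP' => t /andP[-> /leqW ->].
move=> m; have := proper_count_merge re E m => cm.
have -> : (proper_count s (e :: E) m)%:Z
  = (proper_count s E m)%:Z - (proper_count (merge re) E m)%:Z by lia.
have -> : has (implied s) (e :: E) = has (implied s) E.
  by rewrite /= /implied (negbTE re).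
rewrite tsE tsE' !big_cat /= opprD !addrA; congr (_ + _ + _).
  rewrite (proper_count_nil v0) /hs; case: (has _ _); rewrite /= ?big_nil ?oppr0 //.
  rewrite big_seq1 /signed_term size_spreads dE addSn exprS -signr_odd.
  by rewrite addnn odd_double mulr1 mulN1r.
(* The contraction has one root fewer, so every sign flips. *)
rewrite -sumrN; apply: eq_bigr => t _.
by rewrite /signed_term dE addSn exprS mulN1r mulNr.
Qed.

End Frames.

(** * Gain graphs over the trivial frame *)

Lemma roots_trivial (V : finType) : roots (trivial_frame V) = [set: V].
Proof. by apply/setP=> v; rewrite !inE eqxx. Qed.

Definition gain_edges (Phi : int_gain_graph) :
    seq (vertex Phi * vertex Phi * int) :=
  [seq (otail e, Defs.ohead e, gain e) | e <- enum (oedge Phi)].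

Lemma chromZ_proper_count (Phi : int_gain_graph) m :
  chromZ Phi m = proper_count (trivial_frame _) (gain_edges Phi) m.
Proof.
apply: eq_card => x; rewrite !inE.
have -> : tied (trivial_frame (vertex Phi)) x.
  by apply/forallP=> v /=; rewrite addr0.
rewrite all_map /=; apply/forallP/allP => [px e _|px e].
  by have := px e; rewrite /= /satisfied /color /=; lia.
by have := px e (mem_enum _ e); rewrite /= /satisfied /color /=; lia.
Qed.

(** Over singleton blocks, an implied edge is a loop of gain 0. *)
Lemma not_implied_trivial (Phi : int_gain_graph) : no_neutral_loop Phi ->
  has (implied (trivial_frame _)) (gain_edges Phi) = false.
Proof.
move=> hloop; apply/hasP=> -[_ /mapP[e _ ->]].
rewrite /implied /= add0r => /andP[/eqP loop_e /eqP gain_e].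
by have := hloop e loop_e; rewrite -gain_e eqxx.
Qed.

Lemma proper_count_trivial (V : finType) m :
  proper_count (trivial_frame V) [::] m = (m ^ #|V|)%N.
Proof.
rewrite -{2}(card_ord m) -card_ffun.
apply: eq_card => x; rewrite !inE andbT.
by apply/forallP=> v /=; rewrite addr0.
Qed.

(** * Products with roots in decreasing order *)

Definition desc (t : seq nat) : seq nat := sort geq t.

Lemma desc_nth t i : (i.+1 < size t)%N ->
  (nth 0 (desc t) i.+1 <= nth 0 (desc t) i)%N.
Proof.
move=> it; have geq_tot : total geq by move=> a b; exact: leq_total.
by apply: (sortedP 0%N (sort_sorted geq_tot t)); rewrite size_sort.
Qed.

Lemma desc_head_max t h : h \in t -> (h <= nth 0 (desc t) 0)%N.
Proof.
have geq_tot : total geq by move=> a b; exact: leq_total.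
have geq_trans : transitive geq by move=> a b c /= ba cb; exact: leq_trans ba.
rewrite -(mem_sort geq); have := sort_sorted geq_tot t; rewrite -/(desc t).
case: (desc t) => // a u /= /(order_path_min geq_trans)/allP aP.
by rewrite inE => /orP[/eqP->//|/aP].
Qed.

Lemma prod_desc (t : seq nat) (R : comNzRingType) (F : nat -> R) :
  \prod_(1 <= l < (size t).+1) F (nth 0 (desc t) l.-1)%N = \prod_(h <- t) F h.
Proof.
have pt : perm_eq (desc t) t by rewrite perm_sort.
by rewrite -(perm_big _ pt) [RHS](big_nth 0%N) (perm_size pt) big_add1.
Qed.

(* Truncated subtraction makes a product vanish below its largest root. *)
Lemma prod_subn_horner (t : seq nat) m : (0 < size t)%N ->
  (\prod_(h <- t) (m - h))%N%:Z =
  if (nth 0 (desc t) 0 <= m)%N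
  then (\prod_(h <- t) ('X - (h%:Z)%:P)).[m%:Z] else 0.
Proof.
move=> t0; case: leqP => [le|lt].
  rewrite horner_prod -natz natr_prod; apply: eq_big_seq => h ht.
  have := desc_head_max ht; rewrite hornerXsubC natz; lia.
have ht : nth 0%N (desc t) 0 \in t by rewrite -(mem_sort geq) mem_nth ?size_sort.
apply/eqP; rewrite -natz pnatr_eq0 -leqn0 -[leqRHS](muln0 0).
rewrite (big_rem _ ht) /=.
by have -> : (m - nth 0%N (desc t) 0)%N = 0%N by lia.
Qed.

Theorem corollary3p2 (Phi : int_gain_graph) (n : nat)
    (hn : gorder Phi = n) (hn1 : (1 <= n)%N) (hloop : no_neutral_loop Phi) :
  exists (k : nat) (d : nat -> nat) (r : nat -> nat -> int)
         (p : nat -> {poly int}) (mu : nat -> nat),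
    (1 <= k)%N /\
    d 1%N = n /\
    (forall j : nat, (2 <= j <= k)%N -> (0 < d j < n)%N) /\
    (forall j : nat, (1 <= j <= k)%N ->
       p j = \prod_(1 <= l < (d j).+1) ('X - (r j l)%:P) /\
       (forall l : nat, (1 <= l < d j)%N -> r j l.+1 <= r j l) /\
       0 <= r j (d j)) /\
    p 1%N = 'X^n /\
    mu 1%N = 1%N /\
    (forall j : nat, (1 <= j <= k)%N -> (0 < mu j)%N) /\
    (forall m : nat,
       (chromZ Phi m)%:Z =
         m%:Z ^+ n +
         \sum_(2 <= j < k.+1 | r j 1%N <= m%:Z)
            (-1) ^+ (n - d j) * (mu j)%:Z * (p j).[m%:Z]).
Proof.
have /card_gt0P[v0 _] : (0 < #|vertex Phi|)%N by rewrite -/(gorder Phi) hn.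
have [ts []] :=
  proper_count_expansion v0 (gain_edges Phi) (trivial_frame (vertex Phi)).
rewrite roots_trivial cardsT -/(gorder Phi) hn => /allP tsP tsE.
(* Index 1 carries n zero roots, giving ['X^n]; the terms of [ts] are numbered from 2. *)
pose T j := nth [::] (nseq n 0%N :: ts) j.-1.
have T_bounds j : (2 <= j <= (size ts).+1)%N -> (0 < size (T j) < n)%N.
  case: j => [|[|j]] //= jts; apply: tsP; exact: mem_nth.
exists (size ts).+1, (fun j => size (T j)).
exists (fun j l => (nth 0%N (desc (T j)) l.-1)%:Z).
exists (fun j => \prod_(h <- T j) ('X - (h%:Z)%:P)), (fun=> 1%N).
split=> //; split; first by rewrite size_nseq.
split=> //; split.
  move=> j _; split; first by rewrite -prod_desc.
  by split=> // -[//|l] /= lt; rewrite lez_nat desc_nth.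
split.
  by rewrite /T /= big_nseq iter_mulr_1 subr0.
do 2![split=> //].
move=> m; rewrite chromZ_proper_count tsE not_implied_trivial // mulr1n.
rewrite proper_count_trivial -/(gorder Phi) hn -natz natrX natz; congr (_ + _).
rewrite (big_nth [::]) [RHS]big_mkcond 2!big_add1 /= big_nat [RHS]big_nat.
apply: eq_bigr => i /andP[_ its].
have /andP[t0 tn] := T_bounds i.+2 its.
rewrite lez_nat /signed_term /T /= in t0 tn *.
rewrite prod_subn_horner //; case: ifP => _; last by rewrite mulr0.
rewrite mulr1; congr (_ * _).
(* n + d and n - d have the same parity. *)
by rewrite -signr_odd -[RHS]signr_odd oddB ?oddD // ltnW.
Qed.
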